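(* Let $\mathcal A$ be a homological category (i.e. pointed, regular and protomodular) and let $F\colon\mathbb A\to\mathbb B$ be a functor between groupoids in $\mathcal A$. Then $F$ is a $\ast$-fibration in $\mathbf{Grpd}(\mathcal A)$ if and only if its normalization $\mathcal N(F)$ is a $\ast$-fibration in $\mathbf{Arr}(\mathcal A)$.
   Context: Composition is written diagrammatically: $f\cdot g$ means first $f$, then $g$. Pointed means having a zero object $0$. For an arrow $f$, $k_f\colon\mathrm{Ker}(f)\to\cdot$ denotes its kernel. **Internal groupoids.** A groupoid $\mathbb B$ in $\mathcal A$ has object of objects $B_0$, object of arrows $B_1$, domain and codomain $d,c\colon B_1\rightrightarrows B_0$, identities $e\colon B_0\to B_1$, composition $m\colon B_1\times_{c,d}B_1\to B_1$ and inverse $i\colon B_1\to B_1$, satisfying the usual axioms. A functor $F\colon\mathbb A\to\mathbb B$ is a pair $(F_0\colon A_0\to B_0,\ F_1\colon A_1\to B_1)$ compatible with the structure. **$\ast$-fibrations in $\mathbf{Grpd}(\mathcal A)$.** For a functor $F\colon\mathbb A\to\mathbb B$, let $F_1^c\colon\mathrm{Ker}(F_1\cdot c)\to\mathrm{Ker}(c)$ be determined by $F_1^c\cdot k_c=k_{F_1\cdot c}\cdot F_1$ (here $c\colon B_1\to B_0$), let $A_0\times_{F_0,k_c\cdot d}\mathrm{Ker}(c)$ be the pullback of $F_0$ and $k_c\cdot d\colon\mathrm{Ker}(c)\to B_0$, and let $\widehat\tau_d\colon\mathrm{Ker}(F_1\cdot c)\to A_0\times_{F_0,k_c\cdot d}\mathrm{Ker}(c)$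 be the arrow with components $k_{F_1\cdot c}\cdot d$ and $F_1^c$. $F$ is a $\ast$-fibration if $\widehat\tau_d$ is a regular epimorphism. (Equivalently one may exchange the roles of $d$ and $c$.) **The category $\mathbf{Arr}(\mathcal A)$.** Objects are arrows $a\colon A\to A_0$ of $\mathcal A$; morphisms $(f,f_0)\colon a\to b$, where $b\colon B\to B_0$, are pairs $f\colon A\to B$, $f_0\colon A_0\to B_0$ with $f\cdot b=a\cdot f_0$. Such a morphism is essentially surjective if $f_0$ and $b$ are jointly strongly epimorphic (every monomorphism into $B_0$ through which both factor is an isomorphism). The kernel $\mathbb K\mathrm{er}(f,f_0)$ is the level-wise kernel, i.e. the arrow $\mathrm K(a)\colon\mathrm{Ker}(f)\to\mathrm{Ker}(f_0)$ induced by $a$. The strong h-kernel $\mathbb K(f,f_0)$ is the arrow $\partial(f,f_0)_0\colon A\to A_0\times_{f_0,b}B$ into the pullback of $f_0$ and $b$ with components $a$ and $f$. The canonical comparison $J\colon\mathbb K\mathrm{er}(f,f_0)\to\mathbb K(f,f_0)$ is the morphism $(k_f,\langle k_{f_0},0\rangle)$, where $\langle k_{f_0},0\rangle\colon\mathrm{Ker}(f_0)\to A_0\times_{f_0,b}B$. The morphism $(f,f_0)$ is a $\ast$-fibration if $J$ is essentially surjective. **Normalization.** The normalization functor $\mathcal N\colon\mathbf{Grpd}(\mathcal A)\to\mathbf{Arr}(\mathcal A)$ sends a groupoid $\mathbb A$ to $k_d\cdot c\colon\mathrm{Ker}(d)\to A_1\to A_0$, where $k_d$ is the kernel of $d\colon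 A_1\to A_0$, and a functor $F\colon\mathbb A\to\mathbb B$ to the morphism $(\mathrm K_d(F),F_0)$, where $\mathrm K_d(F)$ is the arrow between the kernels of the domain maps determined by $\mathrm K_d(F)\cdot k_d=k_d\cdot F_1$. *)

(* Defs.v *)
Set Implicit Arguments.
Unset Strict Implicit.
Unset Printing Implicit Defensive.

Declare Scope cat_scope.
Delimit Scope cat_scope with cat.
Local Open Scope cat_scope.

Reserved Notation "A ~> B" (at level 70, no associativity).
Reserved Notation "f ;; g" (at level 40, left associativity).

(** Composition is diagrammatic: [f ;; g] is first [f], then [g]. *)
Record Category := {
  Ob :> Type;
  Hom : Ob -> Ob -> Type where "A ~> B" := (Hom A B);
  idm : forall A, A ~> A;
  compose : forall A B C, A ~> B -> B ~> C -> A ~> C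
    where "f ;; g" := (compose f g);
  compose_id_l : forall A B (f : A ~> B), idm A ;; f = f;
  compose_id_r : forall A B (f : A ~> B), f ;; idm B = f;
  compose_assoc : forall A B C D (f : A ~> B) (g : B ~> C) (h : C ~> D),
    f ;; (g ;; h) = f ;; g ;; h
}.

Arguments Hom {c} _ _.
Arguments idm {c} A.
Arguments compose {c A B C} f g.
Notation "A ~> B" := (Hom A B) : cat_scope.
Notation "f ;; g" := (compose f g) : cat_scope.

Section Arrows.
Context {C : Category}.

Definition isMono {A B : C} (f : A ~> B) : Prop :=
  forall (Z : C) (g h : Z ~> A), g ;; f = h ;; f -> g = h.

Definition isIso {A B : C} (f : A ~> B) : Prop :=
  exists g : B ~> A, f ;; g = idm A /\ g ;; f = idm B.

Definition isCoequalizer {Z A Q : C} (u v : Z ~> A) (q : A ~> Q) : Prop :=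
  u ;; q = v ;; q /\
  forall (X : C) (g : A ~> X), u ;; g = v ;; g -> exists! h : Q ~> X, q ;; h = g.

Definition isRegularEpi {A B : C} (f : A ~> B) : Prop :=
  exists (Z : C) (u v : Z ~> A), isCoequalizer u v f.

Definition jointlyStronglyEpi {A B X : C} (f : A ~> X) (g : B ~> X) : Prop :=
  forall (M : C) (m : M ~> X), isMono m ->
    (exists u : A ~> M, u ;; m = f) -> (exists v : B ~> M, v ;; m = g) -> isIso m.

Record Pullback {A B D : C} (f : A ~> D) (g : B ~> D) := {
  pb_ob : C;
  pb_fst : pb_ob ~> A;
  pb_snd : pb_ob ~> B;
  pb_comm : pb_fst ;; f = pb_snd ;; g;
  pb_lift : forall (Z : C) (u : Z ~> A) (v : Z ~> B), u ;; f = v ;; g -> Z ~> pb_ob;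
  pb_lift_fst : forall (Z : C) (u : Z ~> A) (v : Z ~> B) (H : u ;; f = v ;; g),
    pb_lift H ;; pb_fst = u;
  pb_lift_snd : forall (Z : C) (u : Z ~> A) (v : Z ~> B) (H : u ;; f = v ;; g),
    pb_lift H ;; pb_snd = v;
  pb_ext : forall (Z : C) (h k : Z ~> pb_ob),
    h ;; pb_fst = k ;; pb_fst -> h ;; pb_snd = k ;; pb_snd -> h = k
}.

End Arrows.

Record ZeroObject (C : Category) := {
  zero_ob : C;
  to_zero : forall A : C, A ~> zero_ob;
  from_zero : forall A : C, zero_ob ~> A;
  to_zero_unique : forall (A : C) (f g : A ~> zero_ob), f = g;
  from_zero_unique : forall (A : C) (f g : zero_ob ~> A), f = g
}.

(** A zero object is terminal, so together with pullbacks it provides all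
    finite limits.  Limits are chosen, but arbitrarily. *)
Record PointedLexCategory := {
  plc_cat :> Category;
  plc_zero : ZeroObject plc_cat;
  plc_pullback : forall (A B D : plc_cat) (f : A ~> D) (g : B ~> D), Pullback f g
}.

Section Limits.
Context {C : PointedLexCategory}.

Definition pb {A B D : C} (f : A ~> D) (g : B ~> D) : C := pb_ob (plc_pullback f g).
Definition pi1 {A B D : C} (f : A ~> D) (g : B ~> D) : pb f g ~> A :=
  pb_fst (plc_pullback f g).
Definition pi2 {A B D : C} (f : A ~> D) (g : B ~> D) : pb f g ~> B :=
  pb_snd (plc_pullback f g).
Definition pairing {A B D : C} {f : A ~> D} {g : B ~> D} {Z : C}
  (u : Z ~> A) (v : Z ~> B) (H : u ;; f = v ;; g) : Z ~> pb f g :=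
  pb_lift (plc_pullback f g) H.

Definition zero {A B : C} : A ~> B :=
  to_zero (plc_zero C) A ;; from_zero (plc_zero C) B.

(** The kernel of [f] is the pullback of [0 ~> B] along [f]. *)
Definition Ker {A B : C} (f : A ~> B) : C := pb f (from_zero (plc_zero C) B).
Definition ker {A B : C} (f : A ~> B) : Ker f ~> A := pi1 f (from_zero (plc_zero C) B).

Lemma pi_comm {A B D : C} (f : A ~> D) (g : B ~> D) : pi1 f g ;; f = pi2 f g ;; g.
Proof. apply pb_comm. Qed.

Lemma pair_pi1 {A B D : C} {f : A ~> D} {g : B ~> D} {Z : C}
  (u : Z ~> A) (v : Z ~> B) (H : u ;; f = v ;; g) : pairing H ;; pi1 f g = u.
Proof. apply pb_lift_fst. Qed.

Lemma pair_pi2 {A B D : C} {f : A ~> D} {g : B ~> D} {Z : C}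
  (u : Z ~> A) (v : Z ~> B) (H : u ;; f = v ;; g) : pairing H ;; pi2 f g = v.
Proof. apply pb_lift_snd. Qed.

Lemma pair_ext {A B D : C} {f : A ~> D} {g : B ~> D} {Z : C} (h k : Z ~> pb f g) :
  h ;; pi1 f g = k ;; pi1 f g -> h ;; pi2 f g = k ;; pi2 f g -> h = k.
Proof. apply pb_ext. Qed.

Lemma zero_compose_l {A B D : C} (f : B ~> D) : @zero A B ;; f = zero.
Proof.
unfold zero. rewrite <- compose_assoc. f_equal. apply from_zero_unique.
Qed.

Lemma zero_compose_r {A B D : C} (f : A ~> B) : f ;; @zero B D = zero.
Proof.
unfold zero. rewrite compose_assoc. f_equal. apply to_zero_unique.
Qed.

Lemma ker_comp {A B : C} (f : A ~> B) : ker f ;; f = zero.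
Proof.
unfold zero. refine (eq_trans (pi_comm _ _) _). f_equal. apply to_zero_unique.
Qed.

Definition kerLift {A B : C} {f : A ~> B} {Z : C} (u : Z ~> A) (H : u ;; f = zero) :
  Z ~> Ker f := pairing (g := from_zero (plc_zero C) B) H.

Lemma kerLift_ker {A B : C} {f : A ~> B} {Z : C} (u : Z ~> A) (H : u ;; f = zero) :
  kerLift H ;; ker f = u.
Proof. apply pair_pi1. Qed.

Lemma ker_mono {A B : C} (f : A ~> B) : isMono (ker f).
Proof.
intros Z g h E. apply pair_ext; [exact E | apply to_zero_unique].
Qed.

(** Objects and arrows of the category [Pt_Y(C)] of points over [Y], i.e. of split
    epimorphisms with codomain [Y] and a specified section. *)
Record Point (Y : C) := {
  pt_ob : C;
  pt_proj : pt_ob ~> Y;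
  pt_sec : Y ~> pt_ob;
  pt_split : pt_sec ;; pt_proj = idm Y
}.

Record PointHom {Y : C} (P Q : Point Y) := {
  pt_map : pt_ob P ~> pt_ob Q;
  pt_map_proj : pt_map ;; pt_proj Q = pt_proj P;
  pt_map_sec : pt_sec P ;; pt_map = pt_sec Q
}.

(** The change-of-base functor [Pt_Y(C) -> Pt_X(C)] along [f : X ~> Y]. *)
Section ChangeOfBase.
Context {X Y : C} (f : X ~> Y).

Lemma changeOfBase_sec_proof (P : Point Y) :
  idm X ;; f = (f ;; pt_sec P) ;; pt_proj P.
Proof.
now rewrite compose_id_l, <- compose_assoc, pt_split, compose_id_r.
Qed.

Definition changeOfBase (P : Point Y) : Point X := {|
  pt_ob := pb f (pt_proj P);
  pt_proj := pi1 f (pt_proj P);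
  pt_sec := pairing (changeOfBase_sec_proof P);
  pt_split := pair_pi1 (changeOfBase_sec_proof P)
|}.

Lemma changeOfBase_map_proof (P Q : Point Y) (phi : PointHom P Q) :
  pi1 f (pt_proj P) ;; f = (pi2 f (pt_proj P) ;; pt_map phi) ;; pt_proj Q.
Proof. now rewrite <- compose_assoc, pt_map_proj, pi_comm. Qed.

Lemma changeOfBase_map_sec (P Q : Point Y) (phi : PointHom P Q) :
  pt_sec (changeOfBase P) ;; pairing (changeOfBase_map_proof phi) =
  pt_sec (changeOfBase Q).
Proof.
simpl; apply pair_ext; rewrite <- compose_assoc.
- now rewrite !pair_pi1.
- now rewrite !pair_pi2, compose_assoc, pair_pi2, <- compose_assoc, pt_map_sec.
Qed.

Definition changeOfBaseHom (P Q : Point Y) (phi : PointHom P Q) :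
  PointHom (changeOfBase P) (changeOfBase Q) :=
  {| pt_map := pairing (changeOfBase_map_proof phi) : pt_ob (changeOfBase P) ~> pt_ob (changeOfBase Q);
     pt_map_proj := pair_pi1 (changeOfBase_map_proof phi);
     pt_map_sec := changeOfBase_map_sec phi |}.

End ChangeOfBase.

End Limits.

(** Finite limits are part of [C]. *)
Definition isRegular (C : PointedLexCategory) : Prop :=
  (forall (A B : C) (f : A ~> B),
     exists (Q : C) (q : A ~> Q), isCoequalizer (pi1 f f) (pi2 f f) q) /\
  (forall (A B D : C) (f : A ~> D) (g : B ~> D),
     isRegularEpi g -> isRegularEpi (pi1 f g)).

(** Every change-of-base functor of the fibration of points reflects isomorphisms.
    A morphism of points is invertible iff its underlying arrow is, since the inverse
    arrow automatically commutes with the projections and the sections. *)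
Definition isProtomodular (C : PointedLexCategory) : Prop :=
  forall (X Y : C) (f : X ~> Y) (P Q : Point Y) (phi : PointHom P Q),
    isIso (pt_map (changeOfBaseHom f phi)) -> isIso (pt_map phi).

Record HomologicalCategory := {
  hc_cat :> PointedLexCategory;
  hc_regular : isRegular hc_cat;
  hc_protomodular : isProtomodular hc_cat
}.

(** Unit, associativity and inverse laws are stated on generalized elements
    [Z ~> G1]; the quantified composability proofs always exist (by the preceding
    axioms), and [pairing] does not depend on them. *)
Record Groupoid (C : PointedLexCategory) := {
  gr0 : C;
  gr1 : C;
  dom : gr1 ~> gr0;
  cod : gr1 ~> gr0;
  gr_e : gr0 ~> gr1;
  gr_m : pb cod dom ~> gr1;
  gr_i : gr1 ~> gr1;
  e_dom : gr_e ;; dom = idm gr0;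
  e_cod : gr_e ;; cod = idm gr0;
  m_dom : gr_m ;; dom = pi1 cod dom ;; dom;
  m_cod : gr_m ;; cod = pi2 cod dom ;; cod;
  i_dom : gr_i ;; dom = cod;
  i_cod : gr_i ;; cod = dom;
  unit_l : forall (Z : C) (f : Z ~> gr1) (H : f ;; dom ;; gr_e ;; cod = f ;; dom),
    pairing H ;; gr_m = f;
  unit_r : forall (Z : C) (f : Z ~> gr1) (H : f ;; cod = f ;; cod ;; gr_e ;; dom),
    pairing H ;; gr_m = f;
  m_assoc : forall (Z : C) (f g h : Z ~> gr1)
    (Hfg : f ;; cod = g ;; dom) (Hgh : g ;; cod = h ;; dom)
    (Hl : pairing Hfg ;; gr_m ;; cod = h ;; dom)
    (Hr : f ;; cod = pairing Hgh ;; gr_m ;; dom),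
    pairing Hl ;; gr_m = pairing Hr ;; gr_m;
  inv_r : forall (Z : C) (f : Z ~> gr1) (H : f ;; cod = f ;; gr_i ;; dom),
    pairing H ;; gr_m = f ;; dom ;; gr_e;
  inv_l : forall (Z : C) (f : Z ~> gr1) (H : f ;; gr_i ;; cod = f ;; dom),
    pairing H ;; gr_m = f ;; cod ;; gr_e
}.

Arguments gr0 {C} _.
Arguments gr1 {C} _.
Arguments dom {C} {_}.
Arguments cod {C} {_}.
Arguments gr_e {C} {_}.
Arguments gr_m {C} {_}.
Arguments gr_i {C} {_}.

(** Compatibility with inverses follows from the other conditions.  As in
    [Groupoid], the proof [H] exists by [fun_cod] and [fun_dom]. *)
Record GrpdFunctor {C : PointedLexCategory} (A B : Groupoid C) := {
  fun0 : gr0 A ~> gr0 B;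
  fun1 : gr1 A ~> gr1 B;
  fun_dom : fun1 ;; dom = dom ;; fun0;
  fun_cod : fun1 ;; cod = cod ;; fun0;
  fun_e : gr_e ;; fun1 = fun0 ;; gr_e;
  fun_m : forall H : (pi1 cod dom ;; fun1) ;; cod = (pi2 cod dom ;; fun1) ;; dom,
    gr_m ;; fun1 = pairing H ;; gr_m
}.

Section StarFibrationGrpd.
Context {C : PointedLexCategory} {A B : Groupoid C} (F : GrpdFunctor A B).

Lemma F1c_proof : (ker (fun1 F ;; cod) ;; fun1 F) ;; cod = zero.
Proof. now rewrite <- compose_assoc, ker_comp. Qed.

Definition F1c : Ker (fun1 F ;; cod) ~> Ker (@cod C B) := kerLift F1c_proof.

Lemma tau_hat_proof :
  (ker (fun1 F ;; cod) ;; dom) ;; fun0 F = F1c ;; (ker cod ;; dom).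
Proof.
rewrite (compose_assoc F1c). unfold F1c. rewrite kerLift_ker.
now rewrite <- !compose_assoc, fun_dom.
Qed.

Definition tau_hat : Ker (fun1 F ;; cod) ~> pb (fun0 F) (ker cod ;; dom) :=
  pairing tau_hat_proof.

Definition isStarFibrationGrpd : Prop := isRegularEpi tau_hat.

End StarFibrationGrpd.

Record Arr (C : Category) := {
  arr_src : C;
  arr_tgt : C;
  arr_map : arr_src ~> arr_tgt
}.

Record ArrHom {C : Category} (a b : Arr C) := {
  ah_src : arr_src a ~> arr_src b;
  ah_tgt : arr_tgt a ~> arr_tgt b;
  ah_comm : ah_src ;; arr_map b = arr_map a ;; ah_tgt
}.

Definition essentiallySurjective {C : Category} {a b : Arr C} (f : ArrHom a b) : Prop :=
  jointlyStronglyEpi (ah_tgt f) (arr_map b).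

Section StarFibrationArr.
Context {C : PointedLexCategory} {a b : Arr C} (f : ArrHom a b).

Lemma kerArr_proof : (ker (ah_src f) ;; arr_map a) ;; ah_tgt f = zero.
Proof.
now rewrite <- compose_assoc, <- ah_comm, compose_assoc, ker_comp, zero_compose_l.
Qed.

Definition kerArr : Arr C := {|
  arr_src := Ker (ah_src f);
  arr_tgt := Ker (ah_tgt f);
  arr_map := kerLift kerArr_proof
|}.

Definition strongHKer : Arr C := {|
  arr_src := arr_src a;
  arr_tgt := pb (ah_tgt f) (arr_map b);
  arr_map := pairing (eq_sym (ah_comm f))
|}.

Lemma comparison_tgt_proof : ker (ah_tgt f) ;; ah_tgt f = zero ;; arr_map b.
Proof. now rewrite ker_comp, zero_compose_l. Qed.

Lemma comparison_comm :
  ker (ah_src f) ;; arr_map strongHKer = arr_map kerArr ;; pairing comparison_tgt_proof.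
Proof.
simpl; apply pair_ext; rewrite <- !compose_assoc.
- now rewrite !pair_pi1, kerLift_ker.
- now rewrite !pair_pi2, ker_comp, zero_compose_r.
Qed.

Definition comparison : ArrHom kerArr strongHKer := {|
  ah_src := ker (ah_src f) : arr_src kerArr ~> arr_src strongHKer;
  ah_tgt := pairing comparison_tgt_proof : arr_tgt kerArr ~> arr_tgt strongHKer;
  ah_comm := comparison_comm
|}.

Definition isStarFibrationArr : Prop := essentiallySurjective comparison.

End StarFibrationArr.

Definition normalization {C : PointedLexCategory} (A : Groupoid C) : Arr C := {|
  arr_src := Ker (@dom C A);
  arr_tgt := gr0 A;
  arr_map := ker dom ;; cod
|}.

Section NormalizationHom.
Context {C : PointedLexCategory} {A B : Groupoid C} (F : GrpdFunctor A B).

Lemma Kd_proof : (ker dom ;; fun1 F) ;; dom = zero.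
Proof.
now rewrite <- compose_assoc, fun_dom, compose_assoc, ker_comp, zero_compose_l.
Qed.

Definition Kd : Ker (@dom C A) ~> Ker (@dom C B) := kerLift Kd_proof.

Lemma normalization_comm : Kd ;; (ker dom ;; cod) = (ker dom ;; cod) ;; fun0 F.
Proof.
rewrite compose_assoc. unfold Kd. rewrite kerLift_ker.
now rewrite <- !compose_assoc, fun_cod.
Qed.

Definition normalizationHom : ArrHom (normalization A) (normalization B) := {|
  ah_src := Kd : arr_src (normalization A) ~> arr_src (normalization B);
  ah_tgt := fun0 F : arr_tgt (normalization A) ~> arr_tgt (normalization B);
  ah_comm := normalization_comm
|}.

End NormalizationHom.

(* Main.v *)
Require Import Defs.

Set Implicit Arguments.
Unset Strict Implicit.
Unset Printing Implicit Defensive.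
Local Open Scope cat_scope.

(** On elements, the comparison [tau_hat F] sends an arrow [x : a' -> a] of [A] with
    [F a = 0] to [(a', F x)].  Its domain
    [T = Ker (F1 ;; cod)] carries the split epimorphism [x |-> a] onto [Ker F0], with
    section [a |-> 1_a]; the kernel of this split epimorphism is [Ker cod], hence
    [Ker dom] after inversion.  Protomodularity says exactly that a split epimorphism
    is generated by its kernel and its section: the arrows [Ker F0 -> T <- Ker dom] are
    jointly strongly epimorphic ([star_point_generated]).

    Composing these two arrows with [tau_hat F] gives, up to the isomorphism [flip_pb]
    induced by inversion on the codomain, the two arrows whose joint strong epimorphy
    expresses that [normalizationHom F] is a star-fibration: an identity [1_a] goes to
    [(a, 0)], and the inverse of [x : 0 -> a] goes to the pair of [a] and the inverse of
    [F x], which corresponds to [(a, F x)].  A pair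
    obtained by composing a jointly strongly epimorphic pair with [t] is jointly strongly
    epimorphic iff [t] is extremal ([jointly_strong_postcomp]), and in a regular category
    the extremal epimorphisms are the regular ones ([regular_iff_extremal]). *)

(** * Extremal and regular epimorphisms *)

Definition isExtremalEpi {C : Category} {X Y : C} (f : X ~> Y) : Prop :=
  forall (M : C) (m : M ~> Y), isMono m -> (exists u : X ~> M, u ;; m = f) -> isIso m.

Lemma mono_section_iso {C : Category} {X Y : C} (m : X ~> Y) (s : Y ~> X) :
  isMono m -> s ;; m = idm Y -> isIso m.
Proof.
intros Hm Hs; exists s; split; [|exact Hs].
apply Hm; now rewrite <- compose_assoc, Hs, compose_id_l, compose_id_r.
Qed.

Lemma iso_extremal {C : Category} {X Y : C} (f : X ~> Y) : isIso f -> isExtremalEpi f.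
Proof.
intros [g [_ Hg]] M m Hm [u Hu].
apply mono_section_iso with (s := g ;; u); [exact Hm|].
now rewrite <- compose_assoc, Hu.
Qed.

Lemma regularEpi_epi {C : Category} {X Y : C} (f : X ~> Y) :
  isRegularEpi f -> forall (Z : C) (g h : Y ~> Z), f ;; g = f ;; h -> g = h.
Proof.
intros (W & a & b & Hab & Huniv) Z g h E.
destruct (Huniv Z (f ;; g)) as (k & _ & Hk).
{ now rewrite !compose_assoc, Hab. }
now rewrite <- (Hk g eq_refl), <- (Hk h (eq_sym E)).
Qed.

Lemma regularEpi_extremal {C : Category} {X Y : C} (f : X ~> Y) :
  isRegularEpi f -> isExtremalEpi f.
Proof.
intros Hf M m Hm [u Hu].
pose proof (regularEpi_epi Hf) as Hepi.
destruct Hf as (W & a & b & Hab & Huniv).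
destruct (Huniv M u) as (h & Hh & _).
{ apply Hm; now rewrite <- !compose_assoc, Hu. }
apply mono_section_iso with (s := h); [exact Hm|].
apply Hepi; now rewrite compose_assoc, Hh, Hu, compose_id_r.
Qed.

Section Regular.
Context {C : PointedLexCategory}.

(** Generalized elements [g], [h] of [Q] lift along [q] after restriction to a
    regular cover [W] of their domain; if [m] identifies them, the lifts have the same
    image under [q ;; m], so form an element of its kernel pair, and [q] identifies
    them too. *)
Lemma kernel_pair_quotient_mono {X Q Y : C} (q : X ~> Q) (m : Q ~> Y) :
  isRegular C ->
  isCoequalizer (pi1 (q ;; m) (q ;; m)) (pi2 (q ;; m) (q ;; m)) q -> isMono m.
Proof.
intros [_ Hstable] Hq Z g h E.
assert (Hqr : isRegularEpi q) by (now do 3 eexists; exact Hq).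
destruct Hq as [Hq _].
set (w1 := pi1 g q).
set (w2 := pi1 (w1 ;; h) q).
apply (regularEpi_epi (Hstable _ _ _ g q Hqr)).
apply (regularEpi_epi (Hstable _ _ _ (w1 ;; h) q Hqr)).
fold w1; fold w2.
set (a1 := w2 ;; pi2 g q).
set (a2 := pi2 (w1 ;; h) q).
assert (E1 : w2 ;; (w1 ;; g) = a1 ;; q).
{ unfold a1, w1; now rewrite <- compose_assoc, pi_comm. }
assert (E2 : w2 ;; (w1 ;; h) = a2 ;; q) by apply pi_comm.
assert (H : a1 ;; (q ;; m) = a2 ;; (q ;; m)).
{ rewrite !compose_assoc, <- E1, <- E2, <- !compose_assoc; now rewrite E. }
rewrite E1, E2.
transitivity (pairing H ;; pi1 (q ;; m) (q ;; m) ;; q); [now rewrite pair_pi1|].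
now rewrite <- compose_assoc, Hq, compose_assoc, pair_pi2.
Qed.

Lemma regular_iff_extremal {X Y : C} (f : X ~> Y) :
  isRegular C -> isRegularEpi f <-> isExtremalEpi f.
Proof.
intros HC; split; [apply regularEpi_extremal|intros Hf].
destruct (proj1 HC _ _ f) as (Q & q & Hq).
destruct (proj2 Hq _ f (pi_comm f f)) as (m & Hm & _).
(* [f = q ;; m] is the image factorization; extremality makes [m] invertible. *)
assert (Hiso : isIso m).
{ apply Hf; [|now exists q].
  apply kernel_pair_quotient_mono with (q := q); [exact HC|now rewrite Hm]. }
destruct Hiso as (n & Hmn & Hnm), Hq as [Hq Huniv].
exists _, (pi1 f f), (pi2 f f); split; [apply pi_comm|].
intros Z g Hg; destruct (Huniv Z g Hg) as (h & Hh & Hu).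
exists (n ;; h); split.
- now rewrite <- Hm, compose_assoc, <- (compose_assoc q), Hmn, compose_id_r.
- intros k Hk. rewrite (Hu (m ;; k)), compose_assoc, Hnm, compose_id_l; [easy|].
  now rewrite compose_assoc, Hm.
Qed.

(** * Jointly strongly epimorphic pairs *)

Lemma pullback_mono {X Y M : C} (t : X ~> Y) (m : M ~> Y) : isMono m -> isMono (pi1 t m).
Proof.
intros Hm Z g h E; apply pair_ext; [exact E|].
apply Hm; now rewrite <- !compose_assoc, <- pi_comm, !compose_assoc, E.
Qed.

(** If both composites factor through a monomorphism [m], then [f] and [g] factor
    through the pullback of [m] along [t]; so this pullback is invertible and [t]
    itself factors through [m]. *)
Lemma jointly_strong_postcomp {X1 X2 T Y : C} (f : X1 ~> T) (g : X2 ~> T) (t : T ~> Y) :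
  jointlyStronglyEpi f g ->
  jointlyStronglyEpi (f ;; t) (g ;; t) <-> isExtremalEpi t.
Proof.
intros Hfg; split; intros Ht M m Hm.
- intros [w <-]; apply Ht; [exact Hm| |].
  + exists (f ;; w); now rewrite <- compose_assoc.
  + exists (g ;; w); now rewrite <- compose_assoc.
- intros [u Hu] [v Hv]; apply Ht; [exact Hm|].
  destruct (Hfg _ (pi1 t m) (pullback_mono Hm)) as (n & _ & Hn).
  + exists (pairing (eq_sym Hu)); apply pair_pi1.
  + exists (pairing (eq_sym Hv)); apply pair_pi1.
  + exists (n ;; pi2 t m).
    now rewrite <- compose_assoc, <- pi_comm, compose_assoc, Hn, compose_id_l.
Qed.

Lemma jointly_strong_iso {X1 X2 T Y : C} (f : X1 ~> T) (g : X2 ~> T) (t : T ~> Y) :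
  isIso t -> jointlyStronglyEpi f g <-> jointlyStronglyEpi (f ;; t) (g ;; t).
Proof.
intros Ht; split; intros H.
- now apply jointly_strong_postcomp, iso_extremal.
- destruct Ht as (s & Hts & Hst).
  rewrite <- (compose_id_r f), <- (compose_id_r g), <- Hts, !compose_assoc.
  apply jointly_strong_postcomp, iso_extremal; [exact H|now exists t].
Qed.

(** A monomorphism [m] through which the section factors is a morphism of points over
    [Y].  If the kernel factors through it as well, base change along the zero arrow
    makes it invertible, and protomodularity reflects this.  The kernel enters through
    the factorization property [Hker], so that any object with this property may
    represent it. *)
Lemma point_generated {Y : C} (P : Point Y) {K : C} (k : K ~> pt_ob P) :
  isProtomodular C ->
  (forall (Z : C) (t : Z ~> pt_ob P), t ;; pt_proj P = zero -> exists w, w ;; k = t) ->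
  jointlyStronglyEpi (pt_sec P) k.
Proof.
intros HC Hker M m Hm [v Hv] [u Hu].
assert (Hs : v ;; (m ;; pt_proj P) = idm Y) by (now rewrite compose_assoc, Hv, pt_split).
set (P' := {| pt_ob := M; pt_proj := m ;; pt_proj P; pt_sec := v; pt_split := Hs |}).
set (phi := {| pt_map := m : pt_ob P' ~> pt_ob P; pt_map_proj := eq_refl;
               pt_map_sec := Hv |} : PointHom P' P).
set (z := from_zero (plc_zero C) Y).
apply (HC _ _ z _ _ phi).
destruct (Hker _ (pi2 z (pt_proj P))) as [w Hw].
{ rewrite <- pi_comm; unfold zero; f_equal; apply to_zero_unique. }
assert (Hl : pi1 z (pt_proj P) ;; z = w ;; u ;; (m ;; pt_proj P)).
{ now rewrite compose_assoc, <- (compose_assoc w), Hu, Hw, pi_comm. }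
apply mono_section_iso with (s := pairing (g := pt_proj P') Hl).
- intros Z g h E; apply pair_ext; [apply to_zero_unique|].
  apply Hm.
  apply (f_equal (fun a => a ;; pi2 z (pt_proj P))) in E; simpl in E.
  rewrite <- !compose_assoc, !pair_pi2, !compose_assoc in E; exact E.
- simpl; apply pair_ext; [apply to_zero_unique|].
  rewrite <- compose_assoc, pair_pi2, compose_assoc.
  change (pairing (g := pt_proj P') Hl ;; pi2 z (pt_proj P') ;; m =
          idm (pb z (pt_proj P)) ;; pi2 z (pt_proj P)).
  now rewrite pair_pi2, <- compose_assoc, Hu, Hw, compose_id_l.
Qed.

(** * Inversion in internal groupoids *)

Lemma pairing_precomp {X Y D : C} {f : X ~> D} {g : Y ~> D} {Z W : C} (a : W ~> Z)
  (u : Z ~> X) (v : Z ~> Y) (u' : W ~> X) (v' : W ~> Y)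
  (H : u ;; f = v ;; g) (H' : u' ;; f = v' ;; g) :
  a ;; u = u' -> a ;; v = v' -> a ;; pairing H = pairing H'.
Proof.
intros E1 E2; apply pair_ext; rewrite <- compose_assoc.
- now rewrite !pair_pi1.
- now rewrite !pair_pi2.
Qed.

Lemma pairing_eq {X Y D : C} {f : X ~> D} {g : Y ~> D} {Z : C}
  (u u' : Z ~> X) (v v' : Z ~> Y) (H : u ;; f = v ;; g) (H' : u' ;; f = v' ;; g) :
  u = u' -> v = v' -> pairing H = pairing H'.
Proof.
intros E1 E2; rewrite <- (compose_id_l (pairing H)).
apply pairing_precomp; now rewrite compose_id_l.
Qed.

(** The usual computation [y = (x^-1 x) y = x^-1 (x y) = x^-1]. *)
Lemma inverse_unique (G : Groupoid C) {Z : C} (x y : Z ~> gr1 G)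
  (H : x ;; cod = y ;; dom) :
  pairing H ;; gr_m = x ;; dom ;; gr_e -> y = x ;; gr_i.
Proof.
intros E.
assert (Hix : x ;; gr_i ;; cod = x ;; dom) by (now rewrite <- compose_assoc, i_cod).
assert (El : pairing Hix ;; gr_m = y ;; dom ;; gr_e) by now rewrite inv_l, H.
assert (Hl : pairing Hix ;; gr_m ;; cod = y ;; dom).
{ now rewrite El, <- compose_assoc, e_cod, compose_id_r. }
assert (Hr : x ;; gr_i ;; cod = pairing H ;; gr_m ;; dom).
{ now rewrite E, <- (compose_assoc _ gr_e), e_dom, compose_id_r. }
pose proof (m_assoc Hl Hr) as Ha.
assert (Hul : y ;; dom ;; gr_e ;; cod = y ;; dom).
{ now rewrite <- compose_assoc, e_cod, compose_id_r. }
assert (Hur : x ;; gr_i ;; cod = x ;; gr_i ;; cod ;; gr_e ;; dom).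
{ now rewrite <- (compose_assoc _ gr_e), e_dom, compose_id_r. }
rewrite (pairing_eq Hl Hul El eq_refl), unit_l in Ha.
rewrite Ha; refine (eq_trans _ (unit_r Hur)).
f_equal; apply pairing_eq; [reflexivity|now rewrite E, Hix].
Qed.

Lemma inverse_involutive (G : Groupoid C) : gr_i ;; gr_i = idm (gr1 G).
Proof.
assert (H : gr_i ;; cod = idm (gr1 G) ;; dom) by now rewrite i_cod, compose_id_l.
symmetry; apply inverse_unique with (H := H).
assert (H' : idm (gr1 G) ;; gr_i ;; cod = idm _ ;; dom) by now rewrite compose_id_l.
refine (eq_trans (eq_trans _ (inv_l H')) _); [|now rewrite compose_id_l, i_dom].
f_equal; apply pairing_eq; now rewrite ?compose_id_l.
Qed.

Lemma functor_inverse {A B : Groupoid C} (F : GrpdFunctor A B) :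
  gr_i ;; fun1 F = fun1 F ;; gr_i.
Proof.
assert (H : fun1 F ;; cod = gr_i ;; fun1 F ;; dom).
{ now rewrite <- compose_assoc, fun_dom, fun_cod, compose_assoc, i_dom. }
apply inverse_unique with (H := H).
assert (HF : pi1 cod dom ;; fun1 F ;; cod = pi2 cod dom ;; fun1 F ;; dom).
{ now rewrite <- !compose_assoc, fun_dom, fun_cod, !compose_assoc, pi_comm. }
assert (Hi : idm (gr1 A) ;; cod = idm (gr1 A) ;; gr_i ;; dom).
{ now rewrite !compose_id_l, i_dom. }
rewrite fun_dom, <- compose_assoc, <- fun_e, compose_assoc.
transitivity (pairing Hi ;; gr_m ;; fun1 F); [|now rewrite inv_r, compose_id_l].
rewrite <- compose_assoc, (fun_m HF), compose_assoc.
f_equal; symmetry; apply pairing_precomp; rewrite compose_assoc.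
- now rewrite pair_pi1, compose_id_l.
- now rewrite pair_pi2, compose_id_l.
Qed.

Lemma flip_dom_proof (G : Groupoid C) : ker (@dom C G) ;; gr_i ;; cod = zero.
Proof. now rewrite <- compose_assoc, i_cod, ker_comp. Qed.

Lemma flip_cod_proof (G : Groupoid C) : ker (@cod C G) ;; gr_i ;; dom = zero.
Proof. now rewrite <- compose_assoc, i_dom, ker_comp. Qed.

Definition flip_dom (G : Groupoid C) : Ker (@dom C G) ~> Ker (@cod C G) :=
  kerLift (flip_dom_proof G).

Definition flip_cod (G : Groupoid C) : Ker (@cod C G) ~> Ker (@dom C G) :=
  kerLift (flip_cod_proof G).

Lemma flip_dom_cod (G : Groupoid C) : flip_dom G ;; flip_cod G = idm _.
Proof.
apply ker_mono; unfold flip_dom, flip_cod.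
rewrite <- compose_assoc, kerLift_ker, compose_assoc, kerLift_ker.
now rewrite <- compose_assoc, inverse_involutive, compose_id_l, compose_id_r.
Qed.

Lemma flip_cod_dom (G : Groupoid C) : flip_cod G ;; flip_dom G = idm _.
Proof.
apply ker_mono; unfold flip_dom, flip_cod.
rewrite <- compose_assoc, kerLift_ker, compose_assoc, kerLift_ker.
now rewrite <- compose_assoc, inverse_involutive, compose_id_l, compose_id_r.
Qed.

(** * The point carried by the domain of the comparison *)

Section Comparison.
Context {A B : Groupoid C} (F : GrpdFunctor A B).

Lemma flip_pb_proof :
  pi1 (fun0 F) (ker dom ;; cod) ;; fun0 F =
  pi2 (fun0 F) (ker dom ;; cod) ;; flip_dom B ;; (ker cod ;; dom).
Proof.
rewrite pi_comm, <- (compose_assoc _ (flip_dom B)); f_equal.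
unfold flip_dom; now rewrite compose_assoc, kerLift_ker, <- compose_assoc, i_dom.
Qed.

Definition flip_pb : pb (fun0 F) (ker dom ;; cod) ~> pb (fun0 F) (ker cod ;; dom) :=
  pairing flip_pb_proof.

Lemma flip_pb_iso : isIso flip_pb.
Proof.
assert (H : pi1 (fun0 F) (ker cod ;; dom) ;; fun0 F =
  pi2 (fun0 F) (ker cod ;; dom) ;; flip_cod B ;; (ker dom ;; cod)).
{ rewrite pi_comm, <- (compose_assoc _ (flip_cod B)); f_equal.
  unfold flip_cod; now rewrite compose_assoc, kerLift_ker, <- compose_assoc, i_cod. }
exists (pairing H); unfold flip_pb; split; apply pair_ext; rewrite <- compose_assoc.
- now rewrite !pair_pi1, compose_id_l.
- now rewrite pair_pi2, compose_assoc, pair_pi2, <- compose_assoc, flip_dom_cod,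
    compose_id_l, compose_id_r.
- now rewrite !pair_pi1, compose_id_l.
- now rewrite pair_pi2, compose_assoc, pair_pi2, <- compose_assoc, flip_cod_dom,
    compose_id_l, compose_id_r.
Qed.

Lemma star_proj_proof : ker (fun1 F ;; cod) ;; cod ;; fun0 F = zero.
Proof. now rewrite <- compose_assoc, <- fun_cod, ker_comp. Qed.

Lemma star_sec_proof : ker (fun0 F) ;; gr_e ;; (fun1 F ;; cod) = zero.
Proof.
rewrite <- compose_assoc, (compose_assoc gr_e), fun_e, <- (compose_assoc (fun0 F)).
now rewrite e_cod, compose_id_r, ker_comp.
Qed.

Lemma star_split_proof :
  kerLift star_sec_proof ;; kerLift star_proj_proof = idm (Ker (fun0 F)).
Proof.
apply ker_mono; rewrite <- compose_assoc, kerLift_ker, compose_assoc, kerLift_ker.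
now rewrite <- compose_assoc, e_cod, compose_id_l, compose_id_r.
Qed.

Definition star_point : Point (Ker (fun0 F)) := {|
  pt_ob := Ker (fun1 F ;; cod);
  pt_proj := kerLift star_proj_proof;
  pt_sec := kerLift star_sec_proof;
  pt_split := star_split_proof
|}.

Lemma star_fibre_proof : ker dom ;; gr_i ;; (fun1 F ;; cod) = zero.
Proof. now rewrite fun_cod, compose_assoc, flip_dom_proof, zero_compose_l. Qed.

(** On elements, [x : 0 -> a] goes to [x^-1 : a -> 0]: this is the kernel of
    [star_point], represented by [Ker dom]. *)
Definition star_fibre : Ker (@dom C A) ~> pt_ob star_point := kerLift star_fibre_proof.

Lemma star_point_generated :
  isProtomodular C -> jointlyStronglyEpi (pt_sec star_point) star_fibre.
Proof.
intros HC; apply point_generated; [exact HC|]; intros Z t Ht; simpl in *.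
assert (E : t ;; ker (fun1 F ;; cod) ;; gr_i ;; dom = zero).
{ rewrite <- compose_assoc, i_dom.
  apply (f_equal (fun a => a ;; ker (fun0 F))) in Ht.
  now rewrite <- compose_assoc, kerLift_ker, zero_compose_l, compose_assoc in Ht. }
exists (kerLift E); unfold star_fibre; apply ker_mono.
rewrite <- compose_assoc, kerLift_ker, compose_assoc, kerLift_ker.
now rewrite <- compose_assoc, inverse_involutive, compose_id_r.
Qed.

Lemma star_sec_tau_hat :
  pt_sec star_point ;; tau_hat F =
  ah_tgt (comparison (normalizationHom F)) ;; flip_pb.
Proof.
unfold tau_hat, flip_pb; simpl; apply pair_ext; rewrite <- !compose_assoc.
- rewrite !pair_pi1, compose_assoc, kerLift_ker, <- compose_assoc, e_dom.
  now rewrite compose_id_r.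
- rewrite !pair_pi2, compose_assoc, pair_pi2, zero_compose_l.
  apply ker_mono; unfold F1c; rewrite <- compose_assoc, kerLift_ker, compose_assoc.
  rewrite kerLift_ker, <- compose_assoc, fun_e, compose_assoc, ker_comp.
  now rewrite !zero_compose_l.
Qed.

Lemma star_fibre_tau_hat :
  star_fibre ;; tau_hat F =
  arr_map (strongHKer (normalizationHom F)) ;; flip_pb.
Proof.
unfold tau_hat, flip_pb, star_fibre; simpl; apply pair_ext; rewrite <- !compose_assoc.
- rewrite !pair_pi1, compose_assoc, kerLift_ker, <- compose_assoc, i_dom; reflexivity.
- rewrite !pair_pi2, compose_assoc, pair_pi2.
  apply ker_mono; unfold F1c, Kd, flip_dom.
  rewrite <- !compose_assoc, !kerLift_ker, !compose_assoc, !kerLift_ker.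
  now rewrite <- !compose_assoc, functor_inverse.
Qed.

End Comparison.
End Regular.

Theorem mainTheorem5 (C : HomologicalCategory) (A B : Groupoid C) (F : GrpdFunctor A B) :
  isStarFibrationGrpd F <-> isStarFibrationArr (normalizationHom F).
Proof.
apply (iff_trans (regular_iff_extremal (tau_hat F) (hc_regular C))).
apply (iff_trans (iff_sym (jointly_strong_postcomp
  (T := pt_ob (star_point F)) (tau_hat F)
  (star_point_generated (F := F) (hc_protomodular (h := C)))))).
rewrite (star_sec_tau_hat F), (star_fibre_tau_hat F).
apply iff_sym, jointly_strong_iso, flip_pb_iso.
Qed.
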